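(* Let $n\ge 4$ and $4\le k\le 2n-1$ be integers. Then $$\kappa(B_n;P_k)=\kappa^s(B_n;P_k)=\begin{cases}\dfrac{2n-2}{k}, & \text{if } 4\le k\le n-1 \text{ and } k\mid n-1,\\[2mm] \left\lceil\dfrac{2n-1}{k}\right\rceil, & \text{otherwise.}\end{cases}$$
   Context: All graphs are finite and simple. $P_k$ is the path with $k$ vertices. Structure connectivity. For a set $\mathcal{F}$ of subgraphs of a connected graph $G$ (no disjointness is required), let $V(\mathcal{F})$ be the union of the vertex sets of its members and $G-\mathcal{F}=G-V(\mathcal{F})$. $\mathcal{F}$ is a subgraph cut of $G$ if $G-\mathcal{F}$ is disconnected or is a trivial graph (a single vertex). For a connected graph $H$, an $H$-structure cut (resp. $H$-substructure cut) is a subgraph cut each of whose members is isomorphic to $H$ (resp. to a connected subgraph of $H$). $\kappa(G;H)$ (resp. $\kappa^s(G;H)$) is the minimum cardinality of an $H$-structure cut (resp. $H$-substructure cut) of $G$. Crossed cube. Two binary strings $x_1x_0$, $y_1y_0$ are pair related, $x_1x_0\sim y_1y_0$, iff $(x_1x_0,y_1y_0)\in\{(00,00),(10,10),(01,11),(11,01)\}$. $CQ_1=K_2$ with vertices $0,1$. For $n\ge 2$, $CQ_n$ consists of two copies $CQ_{n-1}^0,CQ_{n-1}^1$ of $CQ_{n-1}$ (labels prefixed by $0$ and $1$ respectively), together with an edge between $u=0u_{n-2}\cdots u_0$ and $v=1v_{n-2}\cdots v_0$ iff $u_{n-2}=v_{n-2}$ when $n$ is even, and $u_{2i+1}u_{2i}\sim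 v_{2i+1}v_{2i}$ for all $0\le i<\lfloor\frac{n-1}{2}\rfloor$. BCDC network. $B_2$ is the $4$-cycle with vertices $[00,01],[00,10],[01,11],[10,11]$ (two of these being adjacent iff they share an entry). For $n\ge 3$, $B_{n-1}^0$ (resp. $B_{n-1}^1$) is the copy of $B_{n-1}$ obtained by prefixing both entries of each vertex $[x,y]$ with $0$ (resp. $1$), and $B_n$ consists of $B_{n-1}^0$, $B_{n-1}^1$ and the independent set $S_n=\{[a,b]: a\in V(CQ_{n-1}^0), b\in V(CQ_{n-1}^1), (a,b)\in E(CQ_n)\}$, where $[a,b]\in V(B_{n-1}^0)$ is adjacent to $[c,d]\in S_n$ iff $a=c$ or $b=c$, and $[c,d]\in S_n$ is adjacent to $[e,f]\in V(B_{n-1}^1)$ iff $e=d$ or $f=d$ (there are no edges between $B_{n-1}^0$ and $B_{n-1}^1$). Equivalently, $B_n$ is the line graph of $CQ_n$. *)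

(* Defs.v *)
From HB Require Import structures.
From mathcomp Require Import all_boot.
Set Implicit Arguments. Unset Strict Implicit. Unset Printing Implicit Defensive.

Record sgraph := SGraph {
  vertex :> finType;
  edge : rel vertex;
  edge_sym : symmetric edge;
  edge_irrefl : irreflexive edge }.

Definition isomorphic (G H : sgraph) : Prop :=
  exists2 f : G -> H, bijective f & {mono f : x y / edge x y}.

(* The null graph is neither connected nor disconnected. *)
Definition connected (G : sgraph) : bool :=
  (0 < #|G|) && [forall x : G, forall y : G, connect (@edge G) x y].

Definition disconnected (G : sgraph) : bool :=
  [exists x : G, exists y : G, ~~ connect (@edge G) x y].

Definition trivial_graph (G : sgraph) : bool := #|G| == 1.

(* A subgraph is a vertex set together with a set of unordered edges, not
   necessarily induced. *)
Definition is_subgraph (G : sgraph) (S : {set G} * {set {set G}}) : bool :=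
  [forall e in S.2, (e \subset S.1) &&
    [exists x : G, exists y : G, edge x y && (e == [set x; y])]].

Definition subgraph (G : sgraph) : finType :=
  {S : {set G} * {set {set G}} | is_subgraph S}.

Definition sub_vertices (G : sgraph) (S : subgraph G) : {set G} := (val S).1.
Definition sub_edges (G : sgraph) (S : subgraph G) : {set {set G}} := (val S).2.

Section SubgraphAsGraph.
Variables (G : sgraph) (S : subgraph G).

Definition sub_adj : rel {x : G | x \in sub_vertices S} :=
  fun x y => [set val x; val y] \in sub_edges S.

Lemma sub_adj_sym : symmetric sub_adj.
Proof. by move=> x y; rewrite /sub_adj setUC. Qed.

Lemma sub_adj_irrefl : irreflexive sub_adj.
Proof.
move=> x; apply/negP => /(forall_inP (valP S)) /andP[_].
case/existsP=> y /existsP[z] /andP[yz /eqP exyz].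
have /set1P ey : y \in [set val x] by rewrite -(setUid [set val x]) exyz set21.
have /set1P ez : z \in [set val x] by rewrite -(setUid [set val x]) exyz set22.
by rewrite ey ez edge_irrefl in yz.
Qed.

Definition graph_of_subgraph : sgraph := SGraph sub_adj_sym sub_adj_irrefl.
End SubgraphAsGraph.

Section Delete.
Variables (G : sgraph) (A : {set G}).

Definition delete_adj : rel {x : G | x \notin A} :=
  fun x y => edge (val x) (val y).

Lemma delete_adj_sym : symmetric delete_adj.
Proof. by move=> x y; apply: edge_sym. Qed.

Lemma delete_adj_irrefl : irreflexive delete_adj.
Proof. by move=> x; apply: edge_irrefl. Qed.

Definition delete_vertices : sgraph := SGraph delete_adj_sym delete_adj_irrefl.
End Delete.

Section StructureConnectivity.
Variables G H : sgraph.
Implicit Type F : {set subgraph G}.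

Definition family_vertices F : {set G} := \bigcup_(S in F) sub_vertices S.

Definition subgraph_cut F : bool :=
  let G' := delete_vertices (family_vertices F) in
  disconnected G' || trivial_graph G'.

Definition structure_cut F : Prop :=
  subgraph_cut F /\
  forall S, S \in F -> isomorphic (graph_of_subgraph S) H.

Definition substructure_cut F : Prop :=
  subgraph_cut F /\
  forall S, S \in F -> exists T : subgraph H,
    connected (graph_of_subgraph T) /\
    isomorphic (graph_of_subgraph S) (graph_of_subgraph T).

Definition min_card (P : {set subgraph G} -> Prop) (m : nat) : Prop :=
  (exists2 F, P F & #|F| = m) /\ (forall F, P F -> m <= #|F|).

(* kappa(G;H) = m and kappa^s(G;H) = m; as relations, these include the
   existence of a cut of the required kind. *)
Definition kappa_is (m : nat) : Prop := min_card structure_cut m.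
Definition kappa_s_is (m : nat) : Prop := min_card substructure_cut m.
End StructureConnectivity.

Section PathGraph.
Variable k : nat.

Definition path_adj : rel 'I_k := fun i j => (i.+1 == j) || (j.+1 == i).

Lemma path_adj_sym : symmetric path_adj.
Proof. by move=> i j; rewrite /path_adj orbC. Qed.

Lemma path_adj_irrefl : irreflexive path_adj.
Proof. by move=> i; rewrite /path_adj orbb gtn_eqF. Qed.

Definition path_graph : sgraph := SGraph path_adj_sym path_adj_irrefl.
End PathGraph.

(* A word u_{m-1} ... u_0 is the list [:: u_{m-1}; ...; u_0]: prefixing is
   cons, and bit u i is u_i, counted from the right. *)
Notation word := (seq bool).
Definition bit (u : word) (i : nat) : bool := nth false (rev u) i.

(* The two-bit string x_1 x_0 is encoded as the pair (x_1, x_0). *)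
Definition pair_related (x y : bool * bool) : bool :=
  (x, y) \in [:: ((false, false), (false, false));
                 ((true, false), (true, false));
                 ((false, true), (true, true));
                 ((true, true), (false, true))].

(* Condition for 0u and 1v to be adjacent in CQ_n, where u and v are words of
   length n - 1. *)
Definition cross_related (n : nat) (u v : word) : bool :=
  (~~ odd n ==> (bit u (n - 2) == bit v (n - 2))) &&
  all (fun i => pair_related (bit u (2 * i + 1), bit u (2 * i))
                             (bit v (2 * i + 1), bit v (2 * i)))
      (iota 0 ((n - 1) %/ 2)).

(* Adjacency of CQ_n, on words of length n. *)
Fixpoint cq_adj (n : nat) (u v : word) : bool :=
  match n with
  | 0 => false
  | 1 => u != v
  | n'.+1 =>
    match u, v with
    | a :: u', b :: v' =>
      if a == b then cq_adj n' u' v' else cross_related n u' v'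
    | _, _ => false
    end
  end.

(* The vertex [x,y] is the pair (x, y), with the entries in the order in which
   the construction writes them. *)
Definition B2_vertices : seq (word * word) :=
  [:: ([:: false; false], [:: false; true]);
      ([:: false; false], [:: true; false]);
      ([:: false; true], [:: true; true]);
      ([:: true; false], [:: true; true])].

Definition entry (x : word) (e : word * word) : bool := (x == e.1) || (x == e.2).

Definition prefixed (b : bool) (e : word * word) : bool :=
  (ohead e.1 == Some b) && (ohead e.2 == Some b).
Definition unprefix (e : word * word) : word * word := (behead e.1, behead e.2).

(* The set S_n. *)
Definition crossing (n : nat) (e : word * word) : bool :=
  [&& ohead e.1 == Some false, ohead e.2 == Some true & cq_adj n e.1 e.2].

Fixpoint bcdc_vertex (n : nat) (e : word * word) : bool :=
  match n with
  | 0 | 1 => false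
  | 2 => e \in B2_vertices
  | n'.+1 =>
    [|| prefixed false e && bcdc_vertex n' (unprefix e),
        prefixed true e && bcdc_vertex n' (unprefix e)
      | crossing n e]
  end.

Fixpoint bcdc_adj (n : nat) (e f : word * word) : bool :=
  match n with
  | 0 | 1 => false
  | 2 => (e != f) && (entry e.1 f || entry e.2 f)
  | n'.+1 =>
    [|| [&& prefixed false e, prefixed false f
          & bcdc_adj n' (unprefix e) (unprefix f)],
        [&& prefixed true e, prefixed true f
          & bcdc_adj n' (unprefix e) (unprefix f)],
        [&& prefixed false e, crossing n f & entry f.1 e],
        [&& crossing n e, prefixed false f & entry e.1 f],
        [&& crossing n e, prefixed true f & entry e.2 f]
      | [&& prefixed true e, crossing n f & entry f.2 e]]
  end.

Lemma bcdc_adjSSS n e f : bcdc_adj n.+3 e f =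
  [|| [&& prefixed false e, prefixed false f
        & bcdc_adj n.+2 (unprefix e) (unprefix f)],
      [&& prefixed true e, prefixed true f
        & bcdc_adj n.+2 (unprefix e) (unprefix f)],
      [&& prefixed false e, crossing n.+3 f & entry f.1 e],
      [&& crossing n.+3 e, prefixed false f & entry e.1 f],
      [&& crossing n.+3 e, prefixed true f & entry e.2 f]
    | [&& prefixed true e, crossing n.+3 f & entry f.2 e]].
Proof. by []. Qed.

Lemma bcdc_adj_sym n : symmetric (bcdc_adj n).
Proof.
elim: n => [|[|[|n] IHn]] // e f.
  rewrite /= eq_sym; congr (_ && _); rewrite /entry.
  rewrite !(eq_sym f.1) !(eq_sym f.2).
  by case: (e.1 == f.1); case: (e.1 == f.2); case: (e.2 == f.1).
rewrite !bcdc_adjSSS (IHn (unprefix e)).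
case: (prefixed false e); case: (prefixed false f);
case: (prefixed true e); case: (prefixed true f);
case: (crossing _ e); case: (crossing _ f);
by case: (entry e.1 f); case: (entry e.2 f); case: (entry f.1 e);
   case: (entry f.2 e); case: bcdc_adj.
Qed.

Lemma bcdc_adj_irrefl n : irreflexive (bcdc_adj n).
Proof.
elim: n => [|[|[|n] IHn]] // e; first by rewrite /= eqxx.
rewrite bcdc_adjSSS IHn /prefixed /crossing !andbF /=.
by case: (ohead e.1) => [[]|]; case: (ohead e.2) => [[]|] /=; rewrite ?andbF.
Qed.

Section BCDC.
Variable n : nat.

Definition bcdc_type : finType :=
  {e : n.-tuple bool * n.-tuple bool |
    bcdc_vertex n (tval e.1, tval e.2)}.

Definition bcdc_words (e : bcdc_type) : word * word :=
  (tval (val e).1, tval (val e).2).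

Definition bcdc_edge : rel bcdc_type :=
  fun e f => bcdc_adj n (bcdc_words e) (bcdc_words f).

Lemma bcdc_edge_sym : symmetric bcdc_edge.
Proof. by move=> e f; apply: bcdc_adj_sym. Qed.

Lemma bcdc_edge_irrefl : irreflexive bcdc_edge.
Proof. by move=> e; apply: bcdc_adj_irrefl. Qed.

(* The network B_n, for n >= 2. *)
Definition bcdc : sgraph := SGraph bcdc_edge_sym bcdc_edge_irrefl.
End BCDC.

Definition ceil_div (m d : nat) : nat := m %/ d + ~~ (d %| m).

(* Main.v *)
Require Import Defs.
From mathcomp Require Import all_boot zify.

Set Implicit Arguments. Unset Strict Implicit. Unset Printing Implicit Defensive.

(** The network [B_n] is the line graph of the crossed cube [CQ_n], which is
    [n]-regular and triangle-free. Deleting vertices of [B_n] is deleting edges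
    of [CQ_n]: if the rest of [B_n] is disconnected, the ends of the edges in
    one component form a set [X] whose edge boundary in [CQ_n] is deleted, and
    both [X] and its complement have at least two elements.

    The edge boundary of [X] is controlled by splitting [CQ_n] into its two
    halves, joined by a perfect matching. The boundary has at least [2n - 2]
    edges as soon as both sides have two elements ([boundary_ge2]) and, for
    [n >= 4], at least [2n - 1] as soon as both sides have three elements
    ([boundary_ge3]). Hence a vertex cut of [B_n] has at least [2n - 2]
    elements, and one with exactly [2n - 2] is the neighbourhood of a vertex
    [e] of [B_n] ([min_vertex_cut]). By triangle-freeness that neighbourhood
    consists of two cliques of size [n - 1], without edges between them: the
    edges of [CQ_n] at either end of [e].

    Lower bound. The members of a substructure cut [F] have at most [k]
    vertices each, so [k * |F| >= 2n - 2]. If this is an equality, the cut is the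
    neighbourhood of some [e] and is tiled by the members; each member is
    connected, hence inside one of the two cliques, so that [k] divides [n - 1]
    ([exact_cover]). Otherwise [k * |F| >= 2n - 1].

    Upper bound. If [k] divides [n - 1], each clique is partitioned into paths
    with [k] vertices. Otherwise a 4-cycle of [CQ_n] through [e] supplies one
    more vertex of [B_n] that joins the two cliques to a path with [2n - 1]
    vertices, and this path is covered by windows of [k] consecutive vertices
    ([cover_path]). In both cases [e] becomes isolated. *)

(** * Words and the crossing matching *)

Fixpoint words n : seq word :=
  if n is m.+1 then map (cons false) (words m) ++ map (cons true) (words m)
  else [:: [::]].

Lemma mem_words n w : (w \in words n) = (size w == n).
Proof.
have inj b : injective (cons b : word -> word) by move=> x y [].
elim: n w => [|n IH] [|b w] //=.
  by rewrite mem_cat; apply/norP; split; apply/mapP => -[].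
rewrite mem_cat eqSS -IH; case: b; rewrite (mem_map (inj _)).
  by rewrite orb_idl // => /mapP[].
by rewrite orb_idr // => /mapP[].
Qed.

Lemma uniq_words n : uniq (words n).
Proof.
have inj b : injective (cons b : word -> word) by move=> x y [].
elim: n => //= n IH; rewrite cat_uniq !map_inj_uniq // IH andbT /=.
by apply/hasPn => _ /mapP[x _ ->]; apply/mapP => -[].
Qed.

Lemma size_words n : size (words n) = 2 ^ n.
Proof. by elim: n => //= n IH; rewrite size_cat !size_map IH addnn expnS mul2n. Qed.

(** The partner of [false :: w] in the matching is [true :: twist w]. Positions
    are counted from the right, so [odd (size w')] says that the head stands at
    an odd position, the left half of a two-bit block [x1 x0]; pair relatedness
    sends [x1 x0] to [(x1 xor x0) x0]. *)
Fixpoint twist (w : word) : word :=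
  if w is a :: w' then (a (+) (odd (size w') && head false w')) :: twist w'
  else [::].

Lemma size_twist w : size (twist w) = size w.
Proof. by elim: w => //= a w ->. Qed.

(** The bit added to an odd position is an even one, which [twist] fixes. *)
Lemma twistK : involutive twist.
Proof.
elim=> //= a w IH; rewrite IH size_twist -addbA; congr cons.
case: w {IH} => [|b w] /=; first by rewrite !addbF.
by case: (odd _); rewrite /= ?addbF ?addbb ?addbF.
Qed.

Lemma perm_twist n : perm_eq (map twist (words n)) (words n).
Proof.
apply: uniq_perm; rewrite ?uniq_words ?(map_inj_uniq (can_inj twistK)) ?uniq_words //.
move=> w; rewrite mem_words; apply/mapP/eqP => [[x + ->]|sw].
  by rewrite mem_words size_twist => /eqP.
by exists (twist w); rewrite ?twistK // mem_words size_twist sw.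
Qed.

Lemma bit_cons a w j : bit (a :: w) j = if j == size w then a else bit w j.
Proof.
rewrite /bit rev_cons nth_rcons size_rev.
case: ltngtP => // lt_j; by rewrite nth_default // size_rev ltnW.
Qed.

Lemma bit_twist w j :
  bit (twist w) j = bit w j (+) [&& j < size w, odd j & bit w j.-1].
Proof.
elim: w => [|a w IH]; first by rewrite /= addbF.
rewrite /= bit_cons size_twist !bit_cons ltnS IH.
case: (ltngtP j (size w)) => [lt_j|gt_j|->] /=.
- by rewrite ifN //; lia.
- by [].
case: w {IH} => //= b w; rewrite bit_cons eqxx ifN //; lia.
Qed.

Lemma pair_relatedE x1 x0 y1 y0 :
  pair_related (x1, x0) (y1, y0) = (y1 == x1 (+) x0) && (y0 == x0).
Proof. by case: x1; case: x0; case: y1; case: y0. Qed.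

Lemma eq_bits u v :
  size u = size v -> (forall j, j < size u -> bit u j = bit v j) -> u = v.
Proof.
move=> eq_s eq_b; apply: (can_inj revK).
by apply: (@eq_from_nth _ false); rewrite !size_rev.
Qed.

(** The two-bit blocks determine all bits of [v] when [n] is even. When [n] is
    odd the top bit is left over; it stands at an even position, where [twist]
    copies it, as the separate condition requires. *)
Lemma cross_relatedE n u v :
  size u = n -> size v = n -> cross_related n.+1 u v = (v == twist u).
Proof.
move=> su sv; rewrite /cross_related !subSS subn0 /= negbK.
apply/andP/eqP => [[/implyP top /allP pairs]|->].
  apply: eq_bits => [|j]; first by rewrite size_twist su.
  rewrite sv bit_twist su => lt_j; rewrite lt_j /=.
  have pair : j./2.*2.+1 < n ->
      bit v (j./2.*2.+1) = bit u (j./2.*2.+1) (+) bit u (j./2.*2)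
      /\ bit v (j./2.*2) = bit u (j./2.*2).
    move=> lt_n; have /pairs : j./2 \in iota 0 (n %/ 2) by rewrite mem_iota; lia.
    by rewrite pair_relatedE mul2n addn1 => /andP[/eqP -> /eqP ->].
  case: (boolP (odd j)) => odd_j /=.
    have [ej ->] : j./2.*2.+1 = j /\ j.-1 = j./2.*2 by lia.
    by have [] := pair; rewrite ej.
  have ej : j./2.*2 = j by lia.
  rewrite addbF; have [/pair[_]|ge_n] := ltnP j./2.*2.+1 n; first by rewrite ej.
  have -> : j = n - 1 by lia.
  by apply/esym/eqP/top; lia.
split.
  apply/implyP=> odd_n; rewrite bit_twist.
  by have -> : odd (n - 1) = false; lia.
apply/allP=> /= i; rewrite mem_iota add0n /= => lt_i.
rewrite pair_relatedE !bit_twist su addn1 /= !mul2n odd_double /= andbF addbF eqxx.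
have lt_n : i.*2.+1 < n by lia.
by rewrite lt_n eqxx.
Qed.

(** * The edges of the crossed cube *)

Definition prefix_both (b : bool) (e : word * word) := (b :: e.1, b :: e.2).

(** Each edge is listed once, with the lexicographically smaller end first. *)
Fixpoint cq_edges n : seq (word * word) :=
  if n is m.+1 then
    map (prefix_both false) (cq_edges m) ++ map (prefix_both true) (cq_edges m)
    ++ [seq (false :: w, true :: twist w) | w <- words m]
  else [::].

Lemma prefix_both_inj b : injective (prefix_both b).
Proof. by move=> [x y] [z t] [-> ->]. Qed.

Lemma mem_edgesS n a x b y :
  ((a :: x, b :: y) \in cq_edges n.+1) =
    if a == b then (x, y) \in cq_edges n
    else [&& ~~ a, size x == n & y == twist x].
Proof.
rewrite /= !mem_cat.
have pre c : ((a :: x, b :: y) \in map (prefix_both c) (cq_edges n))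
    = [&& a == c, b == c & (x, y) \in cq_edges n].
  apply/mapP/and3P => [[[z t] zt [-> -> -> ->]]|[/eqP-> /eqP-> xy]] //.
  by exists (x, y).
have -> : ((a :: x, b :: y) \in [seq (false :: w, true :: twist w) | w <- words n])
    = [&& ~~ a, b, size x == n & y == twist x].
  apply/mapP/and4P => [[w + [-> -> -> ->]]|[/negbTE-> -> sx /eqP->]].
    by rewrite mem_words.
  by exists x; rewrite ?mem_words.
by rewrite !pre; case: a {pre}; case: b; rewrite /= ?orbF.
Qed.

Lemma edges_cons n e : e \in cq_edges n.+1 ->
  exists a x b y, e = (a :: x, b :: y).
Proof.
rewrite /= !mem_cat => /or3P[] /mapP[z _ ->];
  by do 4?eexists.
Qed.

Lemma uniq_edges n : uniq (cq_edges n).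
Proof.
elim: n => //= n IH.
rewrite !cat_uniq !(map_inj_uniq (@prefix_both_inj _)) IH has_cat negb_or /=.
rewrite map_inj_uniq ?uniq_words ?andbT; last by move=> x y [].
rewrite -andbA; apply/and3P; split.
all: by apply/hasPn => _ /mapP[x _ ->]; apply/mapP => -[].
Qed.

Lemma size_ends n x y :
  (x, y) \in cq_edges n -> size x = n /\ size y = n.
Proof.
elim: n x y => // n IH x y xy; have [a [x' [b [y' [ex ey]]]]] := edges_cons xy.
move: xy; rewrite ex ey mem_edgesS /=; case: ifP => _; first by case/IH=> -> ->.
by case/and3P => _ /eqP sx /eqP ->; rewrite size_twist sx.
Qed.

Lemma edges_asym n x y : (x, y) \in cq_edges n -> (y, x) \notin cq_edges n.
Proof.
elim: n x y => // n IH x y xy; have [a [x' [b [y' [ex ey]]]]] := edges_cons xy.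
move: xy; rewrite ex ey !mem_edgesS [b == a]eq_sym; case: eqP => [_ /IH //|ab].
by case: a b ab {ex ey} => [] [].
Qed.

Definition cq_related n x y := ((x, y) \in cq_edges n) || ((y, x) \in cq_edges n).

Lemma cq_relatedC n x y : cq_related n x y = cq_related n y x.
Proof. exact: orbC. Qed.

Lemma cq_related_neq n x y : cq_related n x y -> x != y.
Proof.
apply: contraTneq => ->; rewrite /cq_related orbb.
by apply/negP=> /[dup]/edges_asym/negP.
Qed.

Lemma size_cq_related n x y : cq_related n x y -> size x = n.
Proof. by case/orP=> /size_ends[]. Qed.

Lemma cq_relatedS n a x b y : cq_related n.+1 (a :: x) (b :: y) ->
  if a == b then is_true (cq_related n x y) else y = twist x.
Proof.
rewrite /cq_related !mem_edgesS [b == a]eq_sym; case: eqP => // _.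
by case/orP=> /and3P[_ _ /eqP ->]; rewrite ?twistK.
Qed.

(** Two of the three vertices lie in the same half; if the third does not, its
    partner in the matching would be both of them. *)
Lemma triangle_free n x y z :
  cq_related n x y -> cq_related n y z -> cq_related n x z -> False.
Proof.
elim: n x y z => [|n IH] // [|a x] [|b y] [|c z] xy yz xz;
  try by [have := size_cq_related xy | have := size_cq_related yz].
  by move: xz; rewrite cq_relatedC => /size_cq_related.
have {}IH := IH x y z; have twist_inj := can_inj twistK.
move: (cq_relatedS xy) (cq_relatedS yz) (cq_relatedS xz).
move: (cq_related_neq xy) (cq_related_neq yz) (cq_related_neq xz).
case: a {xy xz}; case: b {yz}; case: c => //= nxy nyz nxz; rewrite ?eqxx //=.
all: have irr w : cq_related n w w -> False by move/cq_related_neq; rewrite eqxx.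
all: move=> + + +; try by move=> /[swap] -> /[swap] /twist_inj ->; apply: irr.
all: try by move=> -> ->; rewrite twistK; apply: irr.
all: by move=> -> /[swap] ->; apply: irr.
Qed.

(** The edge at [b :: u] across the two halves is the only one not coming from
    the copy of the smaller cube. *)
Lemma degree n u : size u = n ->
  count (fun e => entry u e) (cq_edges n) = n.
Proof.
elim: n u => // n IH [|b u] // [su].
rewrite /= !count_cat !count_map /=.
have pre c : count (preim (prefix_both c) (entry (b :: u))) (cq_edges n)
    = if b == c then n else 0.
  rewrite -{2}(IH u su); case: eqP => [->|/eqP/negbTE bc].
    by apply: eq_count => e; rewrite /entry /= !eqseq_cons eqxx.
  by apply/eqP; rewrite -leqn0 leqNgt -has_count; apply/hasPn => e _;
     rewrite /entry /= !eqseq_cons bc.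
have -> : count (preim (fun w => (false :: w, true :: twist w)) (entry (b :: u)))
    (words n) = 1.
  pose v := if b then twist u else u.
  have v_words : v \in words n by rewrite mem_words /v; case: (b); rewrite ?size_twist su.
  have <- : nat_of_bool (v \in words n) = 1 by rewrite v_words.
  rewrite -count_uniq_mem ?uniq_words //; apply: eq_count => w.
  rewrite /entry /v /= !eqseq_cons; case: (b) => /=.
    by rewrite -(can_eq twistK) twistK eq_sym.
  by rewrite orbF eq_sym.
by rewrite !pre; case: (b); rewrite /= ?addn0 ?add0n addn1.
Qed.

(** * Edge boundaries in the crossed cube *)

Definition volume n (X : pred word) := count X (words n).
Definition boundary n (X : pred word) :=
  count (fun e => X e.1 != X e.2) (cq_edges n).

Lemma volumeS n (X : pred word) :
  volume n.+1 X = volume n (X \o cons false) + volume n (X \o cons true).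
Proof. by rewrite /volume /= count_cat !count_map. Qed.

Lemma volume_predC n X : volume n X + volume n (predC X) = 2 ^ n.
Proof. by rewrite count_predC size_words. Qed.

Lemma boundary_predC n X : boundary n (predC X) = boundary n X.
Proof. by apply: eq_count => e /=; case: (X _); case: (X _). Qed.

(** The matching between the halves contributes at least the difference of the
    volumes, since it is a bijection. *)
Lemma boundaryS n (X : pred word) :
  let X0 := X \o cons false in let X1 := X \o cons true in
  exists c, [/\ boundary n.+1 X = boundary n X0 + boundary n X1 + c,
    volume n X0 <= volume n X1 + c & volume n X1 <= volume n X0 + c].
Proof.
move=> X0 X1; exists (count (fun w => X0 w != X1 (twist w)) (words n)).
have -> : volume n X1 = count (X1 \o twist) (words n).
  by rewrite -count_map; apply/esym/permP/perm_twist.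
split; first by rewrite /boundary /= !count_cat !count_map addnA.
  rewrite /volume; elim: (words n) => //= w s; case: (X0 w); case: (X1 _) => /=; lia.
rewrite /volume; elim: (words n) => //= w s; case: (X0 w); case: (X1 _) => /=; lia.
Qed.

Lemma volume_le n X : volume n X <= 2 ^ n.
Proof. by rewrite -(volume_predC n X) leq_addr. Qed.

(** For this bound and the next, the halves cut [X] into two parts. If both are
    neither empty nor full, their own boundaries suffice. If one is empty or
    full, the boundary of the other and the difference of the volumes add up to
    enough, since [2 ^ n] exceeds [n]. *)
Lemma boundary_ge1 n X : 0 < volume n X < 2 ^ n -> n <= boundary n X.
Proof.
elim: n X => // n IH X; rewrite volumeS expnS.
have [c [-> ge0 ge1]] := boundaryS n X.
move: (IH (X \o cons false)) (IH (X \o cons true)) ge0 ge1.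
move: (volume_le n (X \o cons false)) (volume_le n (X \o cons true)).
have := ltn_expl n (isT : 1 < 2); case: n {IH} => [|n]; rewrite ?expn0; lia.
Qed.

Lemma boundary_ge2 n X :
  2 <= volume n X -> volume n X + 2 <= 2 ^ n -> 2 * n - 2 <= boundary n X.
Proof.
elim: n X => // n IH X; rewrite volumeS.
have [c [-> ge0 ge1]] := boundaryS n X.
move: (IH (X \o cons false)) (IH (X \o cons true)) ge0 ge1.
move: (@boundary_ge1 n (X \o cons false)) (@boundary_ge1 n (X \o cons true)).
move: (volume_le n (X \o cons false)) (volume_le n (X \o cons true)).
case: n {IH} => [|n]; first by rewrite expn1 expn0; lia.
have := ltn_expl n (isT : 1 < 2); rewrite !expnS; lia.
Qed.

(** Let both parts be neither empty nor full. If one of them has two elements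
    on both of its sides it contributes [2n - 4], the other one [n - 1], and
    [(2n - 4) + (n - 1) >= 2n - 1] is where [4 <= n] enters; for [n = 3] a
    4-cycle is a counterexample. Otherwise one part has a single element and
    the other misses a single one, so that their volumes differ. An empty or
    full part is compensated by the volumes as before. *)
Lemma boundary_ge3 n X : 4 <= n ->
  3 <= volume n X -> volume n X + 3 <= 2 ^ n -> 2 * n - 1 <= boundary n X.
Proof.
case: n => // n n_ge3; rewrite volumeS.
have [c [-> ge0 ge1]] := boundaryS n X.
move: (@boundary_ge2 n (X \o cons false)) (@boundary_ge2 n (X \o cons true)) ge0 ge1.
move: (@boundary_ge1 n (X \o cons false)) (@boundary_ge1 n (X \o cons true)).
move: (volume_le n (X \o cons false)) (volume_le n (X \o cons true)).
case: n n_ge3 => [|[|[|n]]] //= _.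
have := ltn_expl n (isT : 1 < 2); rewrite !expnS; lia.
Qed.

(** * The network is the line graph of the crossed cube *)

Lemma unprefix_both b e : unprefix (prefix_both b e) = e.
Proof. by case: e. Qed.

Lemma crossingE n w w' : size w = n.+2 -> size w' = n.+2 ->
  crossing n.+3 (false :: w, true :: w') = (w' == twist w).
Proof.
move=> sw sw'; rewrite /crossing.
have -> : cq_adj n.+3 (false :: w) (true :: w') = cross_related n.+3 w w' by [].
by rewrite cross_relatedE.
Qed.

Lemma bcdc_vertexE n x y : 2 <= n -> size x = n -> size y = n ->
  bcdc_vertex n (x, y) = ((x, y) \in cq_edges n).
Proof.
case: n => [|[|n]] // _; elim: n x y => [|n IH] [|a x] [|b y] //.
  by case: x y => [|a' [|? ?]] [|b' [|? ?]] //; case: a; case: b; case: a'; case: b'.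
move=> [sx] [sy]; rewrite mem_edgesS.
have -> : bcdc_vertex n.+3 (a :: x, b :: y) =
  [|| prefixed false (a :: x, b :: y) && bcdc_vertex n.+2 (x, y),
      prefixed true (a :: x, b :: y) && bcdc_vertex n.+2 (x, y)
    | crossing n.+3 (a :: x, b :: y)] by [].
rewrite (IH x y) // /prefixed /=; case: a; case: b => //=; rewrite ?orbF //.
by rewrite crossingE // sx eqxx.
Qed.

Definition share (e f : word * word) := entry e.1 f || entry e.2 f.

Lemma share_prefix b c e f :
  share (prefix_both b e) (prefix_both c f) = (b == c) && share e f.
Proof. by rewrite /share /entry /= !eqseq_cons; case: (b == c). Qed.

Variant edge_cons_spec n : word * word -> Prop :=
| EdgePrefix b e of e \in cq_edges n : edge_cons_spec n (prefix_both b e)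
| EdgeCross w of size w = n : edge_cons_spec n (false :: w, true :: twist w).

Lemma edgeP n e : e \in cq_edges n.+1 -> edge_cons_spec n e.
Proof.
rewrite /= !mem_cat => /or3P[] /mapP[x + ->]; last rewrite mem_words => /eqP.
all: by constructor.
Qed.

(** The recursive adjacency lists the possible common ends case by case. Two
    crossing edges are never adjacent there, and they share no end because the
    crossing edges form a matching; edges in opposite halves share no end. *)
Lemma bcdc_adjE n e f : 2 <= n -> e \in cq_edges n -> f \in cq_edges n ->
  bcdc_adj n e f = (e != f) && share e f.
Proof.
case: n => [|[|n]] // _; elim: n e f => [|n IH] e f // e_n f_n.
rewrite bcdc_adjSSS; case: (edgeP e_n) => [b e' e'_n|w sw].
all: case: (edgeP f_n) => [c f' f'_n|w' sw'].
- rewrite !unprefix_both share_prefix IH //.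
  have -> : (prefix_both b e' != prefix_both c f') = ~~ ((b == c) && (e' == f')).
    case: e' f' {e'_n f'_n e_n f_n} => [x y] [z t].
    by rewrite /prefix_both /= -!pair_eqE /pair_eq /= !eqseq_cons; case: (b == c).
  by case: b {e_n}; case: c {f_n}; rewrite /crossing /= ?orbF ?andbF.
- rewrite crossingE ?size_twist // eqxx -pair_eqE /pair_eq.
  rewrite /prefixed /crossing /share /entry /= !eqseq_cons.
  case: b {e_n}; rewrite /= ?orbF ?andbF //=;
  by rewrite ![_ == e'.1]eq_sym ![_ == e'.2]eq_sym.
- rewrite crossingE ?size_twist // eqxx -pair_eqE /pair_eq.
  rewrite /prefixed /crossing /share /entry /= !eqseq_cons.
  by case: c {f_n}; rewrite /= ?orbF ?andbF.
rewrite !crossingE ?size_twist // !eqxx /prefixed /share /entry /=.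
rewrite -pair_eqE /pair_eq /= !eqseq_cons /= (can_eq twistK).
by case: (w == w').
Qed.

Lemma bcdc_words_inj n : injective (@bcdc_words n).
Proof.
move=> [[x y] xy] [[z t] zt] [/val_inj ? /val_inj ?].
by apply: val_inj; congr pair.
Qed.

Lemma bcdc_words_edge n (e : bcdc n) : 2 <= n -> bcdc_words e \in cq_edges n.
Proof.
by case: e => [[x y] xy] n_ge2; rewrite -bcdc_vertexE ?size_tuple.
Qed.

Lemma bcdc_of_edge n e : 2 <= n -> e \in cq_edges n ->
  exists g : bcdc n, bcdc_words g = e.
Proof.
case: e => x y n_ge2 /[dup] /size_ends [/eqP sx /eqP sy] xy.
have xyB : bcdc_vertex n (tval (Tuple sx), tval (Tuple sy)).
  by rewrite bcdc_vertexE ?(eqP sx) ?(eqP sy).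
by exists (exist _ (Tuple sx, Tuple sy) xyB).
Qed.

Lemma edge_bcdc n (e f : bcdc n) : 2 <= n ->
  edge e f = (e != f) && share (bcdc_words e) (bcdc_words f).
Proof.
by move=> n_ge2; rewrite /= /bcdc_edge bcdc_adjE ?bcdc_words_edge //.
Qed.

Lemma card_bcdc n (P : pred (word * word)) : 2 <= n ->
  #|[set e : bcdc n | P (bcdc_words e)]| = count P (cq_edges n).
Proof.
move=> n_ge2; rewrite cardsE cardE -size_filter -(size_map (@bcdc_words n)).
apply/perm_size/uniq_perm; first by rewrite (map_inj_uniq (@bcdc_words_inj n)) enum_uniq.
  by rewrite filter_uniq ?uniq_edges.
move=> e; rewrite mem_filter; apply/mapP/andP => [[g + ->]|[Pe e_n]].
  by rewrite mem_enum; split; rewrite ?bcdc_words_edge.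
have [g eg] := bcdc_of_edge n_ge2 e_n.
by exists g => //; rewrite mem_enum unfold_in eg.
Qed.

(** * Structure cuts and path subgraphs *)

Lemma connect_homo (T T' : finType) (e : rel T) (e' : rel T') (f : T -> T') :
    {homo f : x y / e x y >-> e' x y} ->
  forall x y, connect e x y -> connect e' (f x) (f y).
Proof.
move=> ef x y /connectP[p + ->] {y}; elim: p x => //= z p IH x /andP[xz zp].
exact: connect_trans (connect1 (ef _ _ xz)) (IH _ zp).
Qed.

Lemma isomorphic_trans G H K : isomorphic G H -> isomorphic H K -> isomorphic G K.
Proof.
move=> [f bf mf] [g bg mg]; exists (g \o f); first exact: bij_comp.
by move=> x y /=; rewrite mg mf.
Qed.

Lemma isomorphic_sym G H : isomorphic G H -> isomorphic H G.
Proof.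
move=> [f [g fK gK] mf]; exists g; first by exists f.
by move=> x y; rewrite -mf !gK.
Qed.

Lemma isomorphic_card G H : isomorphic G H -> #|G| = #|H|.
Proof. by case=> f /bij_eq_card. Qed.

Lemma isomorphic_connected G H : isomorphic G H -> connected H -> connected G.
Proof.
move=> iso /andP[H_gt0 /forallP conn]; rewrite /connected (isomorphic_card iso) H_gt0.
have [g [f gK fK] mg] := isomorphic_sym iso.
apply/forallP=> x; apply/forallP=> y; rewrite -(fK x) -(fK y).
by apply: (connect_homo _ (forallP (conn _) _)) => u v; rewrite mg.
Qed.

Lemma path_connected k : 0 < k -> connected (path_graph k).
Proof.
case: k => // k _; rewrite /connected card_ord /=.
have conn (j : 'I_k.+1) : connect (@edge (path_graph k.+1)) ord0 j.
  case: j => j lt_j; elim: j lt_j => [|j IH] lt_j.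
    by have -> : Ordinal lt_j = ord0 by exact: val_inj.
  apply: connect_trans (IH (ltnW lt_j)) (connect1 _).
  by rewrite /edge /= /path_adj /= eqxx.
apply/forallP=> x; apply/forallP=> y; apply: connect_trans (conn y).
by rewrite sym_connect_sym //; apply: path_adj_sym.
Qed.

Lemma set2_eq (T : finType) (x y a b : T) :
  [set x; y] = [set a; b] -> x = a /\ y = b \/ x = b /\ y = a.
Proof.
move=> eq_set; have : x \in [set a; b] by rewrite -eq_set set21.
have : y \in [set a; b] by rewrite -eq_set set22.
have : a \in [set x; y] by rewrite eq_set set21.
have : b \in [set x; y] by rewrite eq_set set22.
by move=> /set2P + /set2P + /set2P + /set2P; intuition congruence.
Qed.

Lemma edge_of_subgraph (G : sgraph) (S : subgraph G) (x y : graph_of_subgraph S) :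
  edge x y -> edge (val x) (val y).
Proof.
move=> xy; case/andP: (forall_inP (valP S) _ xy) => _.
case/existsP=> a /existsP[b /andP[ab /eqP eq_set]].
by have [[-> ->]|[-> ->]] := set2_eq eq_set; rewrite // edge_sym.
Qed.

Lemma card_subgraph (G : sgraph) (S : subgraph G) :
  #|graph_of_subgraph S| = #|sub_vertices S|.
Proof. by rewrite card_sig; apply: eq_card => x; rewrite inE. Qed.

Lemma path_subgraph (G : sgraph) (p : seq G) : uniq p -> sorted (@edge G) p ->
  exists S : subgraph G, sub_vertices S = [set x in p] /\
    isomorphic (graph_of_subgraph S) (path_graph (size p)).
Proof.
move=> p_uniq p_path.
pose E := [set [set xy.1; xy.2] | xy in [set xy : G * G |
  [&& xy.1 \in p, xy.2 \in p & (index xy.1 p).+1 == index xy.2 p]]].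
have sub : is_subgraph ([set x in p], E).
  apply/forall_inP => e /= /imsetP[[x y]]; rewrite inE /= => /and3P[xp yp /eqP xy] ->.
  rewrite subUset !sub1set !inE xp yp /=; apply/existsP; exists x; apply/existsP; exists y.
  rewrite eqxx andbT -(nth_index x xp) -(nth_index x yp) -xy.
  by move/(sortedP x): p_path; apply; rewrite xy index_mem.
pose S : subgraph G := exist (fun S => is_subgraph S) _ sub; exists S; split=> //.
have in_p (z : graph_of_subgraph S) : val z \in p by have := valP z; rewrite inE.
have lt_p (z : graph_of_subgraph S) : index (val z) p < size p by rewrite index_mem in_p.
exists (fun z => Ordinal (lt_p z)).
  apply: inj_card_bij => [x y [] eq_xy|].
    by apply: val_inj; rewrite -(nth_index (val x) (in_p x)) eq_xy nth_index ?in_p.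
  rewrite card_subgraph card_ord cardsE.
  by have /card_uniqP -> := p_uniq.
move=> x y; rewrite /edge /= /path_adj /= /sub_adj /sub_edges /=.
apply/orP/imsetP => [[eq_xy|eq_yx]|[[a b]]].
- by exists (val x, val y); rewrite ?inE /= ?in_p ?eq_xy.
- by exists (val y, val x); rewrite ?inE /= ?in_p ?eq_yx // setUC.
rewrite inE /= => /and3P[_ _ ab] /set2_eq.
by case=> [[-> ->]|[-> ->]]; [left|right].
Qed.

Lemma ceil_div_leq m k x : 0 < k -> (ceil_div m k <= x) = (m <= x * k).
Proof.
move=> k_gt0; rewrite /ceil_div /dvdn {3}(divn_eq m k).
have := ltn_pmod m k_gt0; case: (m %% k) => [|r] lt_r /=.
  by rewrite !addn0 leq_pmul2r.
rewrite addn1; case: ltnP => [lt_x|le_x].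
  have : (m %/ k).+1 * k <= x * k by rewrite leq_mul2r lt_x orbT.
  by rewrite mulSn; lia.
have : x * k <= m %/ k * k by rewrite leq_mul2r le_x orbT.
by lia.
Qed.

Lemma nth_window (T : eqType) (x0 : T) p s k j :
    uniq p -> s + k <= size p -> j < size p ->
  (nth x0 p j \in take k (drop s p)) = (s <= j < s + k).
Proof.
move=> p_uniq le_sk lt_j; have sz : size (take k (drop s p)) = k.
  by rewrite size_takel // size_drop; lia.
apply/(nthP x0)/idP => [[i]|/andP[le_sj lt_jk]].
  rewrite sz => lt_i; rewrite nth_take // nth_drop => /eqP.
  by rewrite nth_uniq //; lia.
exists (j - s); first by rewrite sz; lia.
by rewrite nth_take ?nth_drop; [congr nth|]; lia.
Qed.

(** Windows of [k] vertices start at the multiples of [k], except that the last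
    one is moved back to end with the path. All starting points stay distinct,
    so that the windows are distinct subgraphs, as counting them requires. *)
Lemma cover_path (G : sgraph) (p : seq G) k :
    uniq p -> sorted (@edge G) p -> 0 < k <= size p ->
  exists F : {set subgraph G}, [/\ #|F| = ceil_div (size p) k,
    family_vertices F = [set x in p] &
    forall S, S \in F -> isomorphic (graph_of_subgraph S) (path_graph k)].
Proof.
move=> p_uniq p_path /andP[k_gt0 k_le]; set m := size p in k_le *.
set c := ceil_div m k.
have lt_c i : (i < c) = (i * k < m) by rewrite ltnNge ceil_div_leq // -ltnNge.
pose s (i : 'I_c) := minn (i * k) (m - k).
have s_le i : s i + k <= size p by rewrite /s -/m; lia.
have [x0 _] : exists x0 : G, x0 \in p.
  case: p @m k_le {p_uniq p_path c lt_c s s_le} => [|x p] /=; first by lia.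
  by exists x; rewrite mem_head.
have ex i : exists S : subgraph G,
    sub_vertices S = [set x in take k (drop (s i) p)] /\
    isomorphic (graph_of_subgraph S) (path_graph k).
  have := @path_subgraph G (take k (drop (s i) p)).
  rewrite size_takel ?size_drop; last by have := s_le i; lia.
  by apply; [rewrite take_uniq ?drop_uniq|rewrite take_sorted ?drop_sorted].
have [S SP] := fin_all_exists ex.
have mem_S i j : j < m -> (nth x0 p j \in sub_vertices (S i)) = (s i <= j < s i + k).
  by move=> lt_j; rewrite (proj1 (SP i)) inE nth_window.
(* Equal windows start at the same place, by symmetry. *)
have le_S i j : sub_vertices (S i) = sub_vertices (S j) -> s j <= s i.
  move=> eq_S; have lt_m : s i < m by have := s_le i; rewrite -/m; lia.
  by have := mem_S i _ lt_m; rewrite eq_S mem_S //; lia.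
have S_inj : injective S.
  move=> i j eq_S; have eq_s : s i = s j.
    by apply/eqP; rewrite eqn_leq !le_S // eq_S.
  apply: val_inj; move: (ltn_ord i) (ltn_ord j) eq_s; rewrite !lt_c /s /=.
  have [lt_ij|lt_ji|//] := ltngtP i j => Hi Hj.
    by have := leq_mul lt_ij (leqnn k); rewrite mulSn; lia.
  by have := leq_mul lt_ji (leqnn k); rewrite mulSn; lia.
exists [set S i | i : 'I_c]; split.
- by rewrite card_imset // card_ord.
- apply/setP=> x; rewrite inE; apply/bigcupP/idP => [[_ /imsetP[i _ ->]]|xp].
    by rewrite (proj1 (SP i)) inE => /mem_take /mem_drop.
  have lt_x : index x p < m by rewrite index_mem.
  have lt_i : index x p %/ k < c by rewrite lt_c; apply: leq_ltn_trans lt_x; apply: leq_divM.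
  exists (S (Ordinal lt_i)); first exact: imset_f.
  rewrite -{1}(nth_index x0 xp) mem_S // /s /=.
  have := divn_eq (index x p) k; have := ltn_pmod (index x p) k_gt0; lia.
- by move=> _ /imsetP[i _ ->]; exact: (proj2 (SP i)).
Qed.

(** A graph is a subgraph of itself, up to isomorphism. *)
Lemma structure_substructure (G H : sgraph) (F : {set subgraph G}) :
  connected H -> structure_cut H F -> substructure_cut H F.
Proof.
move=> connH [cutF isoF]; split=> // S /isoF iso.
pose E := [set [set xy.1; xy.2] | xy in [set xy : H * H | edge xy.1 xy.2]].
have sub : is_subgraph ([set: H], E).
  apply/forall_inP => e /imsetP[[x y]]; rewrite inE /= => xy ->; rewrite subsetT.
  by apply/existsP; exists x; apply/existsP; exists y; rewrite xy eqxx.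
pose T : subgraph H := exist (fun S => is_subgraph S) _ sub.
have isoT : isomorphic (graph_of_subgraph T) H.
  exists val.
    apply: inj_card_bij; first exact: val_inj.
    by rewrite card_subgraph cardsT.
  move=> x y; rewrite /edge /= /sub_adj /sub_edges /=; apply/idP/imsetP => [xy|[[a b]]].
    by exists (val x, val y); rewrite ?inE.
  rewrite inE /= => ab /set2_eq[[-> ->]|[-> ->]] //.
  by rewrite /is_true -ab; apply: edge_sym.
exists T; split; first exact: isomorphic_connected isoT connH.
exact: isomorphic_trans iso (isomorphic_sym isoT).
Qed.

Lemma substructureP (G H : sgraph) (F : {set subgraph G}) S :
    substructure_cut H F -> S \in F ->
  #|sub_vertices S| <= #|H| /\ connected (graph_of_subgraph S).
Proof.
move=> [_ sF] /sF[T [connT iso]]; split; last exact: isomorphic_connected iso connT.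
by rewrite -card_subgraph (isomorphic_card iso) card_subgraph max_card.
Qed.

Lemma card_family_vertices (G : sgraph) (F : {set subgraph G}) k :
    (forall S, S \in F -> #|sub_vertices S| <= k) ->
  #|family_vertices F| <= k * #|F|.
Proof.
move=> le_k; rewrite mulnC -sum_nat_const.
apply: (@leq_trans (\sum_(S in F) #|sub_vertices S|)); last exact: leq_sum.
rewrite /family_vertices.
elim/big_rec2: _ => [|S x y _ IH]; first by rewrite cards0.
by apply: leq_trans (leq_card_setU _ _) _; rewrite leq_add2l.
Qed.

(** When no vertex other than [e] remains, the rest is the trivial graph, which
    also counts as a cut. *)
Lemma subgraph_cut_isolated (G : sgraph) (F : {set subgraph G}) (e : G) :
    e \notin family_vertices F ->
    (forall f, edge e f -> f \in family_vertices F) ->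
  subgraph_cut F.
Proof.
rewrite /subgraph_cut; set W := family_vertices F => eW nW.
pose e' : delete_vertices W := exist (fun x => x \notin W) e eW.
have [f fe|all_e] := pickP (fun f : delete_vertices W => f != e'); last first.
  apply/orP; right; rewrite /trivial_graph; apply/eqP; rewrite -[RHS](card1 e').
  apply: eq_card => f.
  by rewrite !inE (negbFE (all_e f)).
apply/orP; left; apply/existsP; exists e'; apply/existsP; exists f.
apply: contra fe => /connectP[[|g p] /= ]; first by move=> _ ->.
case/andP => eg _ _; by have := valP g; rewrite nW.
Qed.

Lemma connected_split (G : sgraph) (S : subgraph G) (A B : {set G}) :
    connected (graph_of_subgraph S) -> sub_vertices S \subset A :|: B ->
    (forall x y, x \in A -> y \in B -> ~~ edge x y) ->
  (sub_vertices S \subset A) || (sub_vertices S \subset B).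
Proof.
move=> /andP[_ /forallP conn] sub sep; apply/orP.
have [/subsetP|/subsetPn[x xS xA]] := boolP (sub_vertices S \subset A); [by left|right].
have xB : x \in B by have := subsetP sub x xS; rewrite inE (negbTE xA).
pose in_S z (zS : z \in sub_vertices S) : graph_of_subgraph S :=
  exist (fun z => z \in sub_vertices S) z zS.
have closedB (u v : graph_of_subgraph S) : connect (@edge _) u v ->
    val u \in B -> val v \in B.
  case/connectP=> p + ->; elim: p u => //= w p IH u /andP[/edge_of_subgraph uw wp] uB.
  apply: (IH w wp); have := subsetP sub _ (valP w); rewrite inE.
  by case: (boolP (val w \in A)) => //= wA; move: (sep _ _ wA uB); rewrite edge_sym uw.
by apply/subsetP => y yS; exact: (closedB _ _ (forallP (conn (in_S x xS)) (in_S y yS)) xB).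
Qed.

(** * Neighbourhoods in the network *)

(** In the line graph, the neighbours of [e] through its end [u]. *)
Definition star n (e : bcdc n) (u : word) : {set bcdc n} :=
  [set g | entry u (bcdc_words g) && (g != e)].

Definition end1 n (e : bcdc n) := (bcdc_words e).1.
Definition end2 n (e : bcdc n) := (bcdc_words e).2.

Lemma entry_end1 n (e : bcdc n) : entry (end1 e) (bcdc_words e).
Proof. by rewrite /entry eqxx. Qed.

Lemma entry_end2 n (e : bcdc n) : entry (end2 e) (bcdc_words e).
Proof. by rewrite /entry eqxx orbT. Qed.

Lemma related_ends n (e : bcdc n) : 2 <= n -> cq_related n (end1 e) (end2 e).
Proof. by move/(bcdc_words_edge e); rewrite /cq_related -surjective_pairing => ->. Qed.

Lemma entry_related n (e : bcdc n) u : 2 <= n -> entry u (bcdc_words e) ->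
  exists2 w, cq_related n u w & forall x, entry x (bcdc_words e) = (x == u) || (x == w).
Proof.
move=> /(related_ends e) e_rel /orP[] /eqP ->; first by exists (end2 e).
by exists (end1 e); [rewrite cq_relatedC|move=> x; rewrite orbC].
Qed.

Lemma eq_edge n (e f : bcdc n) u v : 2 <= n -> u != v ->
  entry u (bcdc_words e) -> entry v (bcdc_words e) ->
  entry u (bcdc_words f) -> entry v (bcdc_words f) -> e = f.
Proof.
move=> n_ge2 uv eu ev fu fv; apply: bcdc_words_inj; move: uv eu ev fu fv.
have := bcdc_words_edge e n_ge2; have := bcdc_words_edge f n_ge2.
case: (bcdc_words e) (bcdc_words f) => [x y] [z t] zt xy; rewrite /entry /=.
move=> + /orP[]/eqP eu /orP[]/eqP ev /orP[]/eqP fu /orP[]/eqP fv.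
all: subst; rewrite ?eqxx //.
all: by move: (edges_asym xy); rewrite ?zt; subst; rewrite ?zt.
Qed.

Lemma edge_star n (e g : bcdc n) : 2 <= n ->
  edge e g = (g \in star e (end1 e) :|: star e (end2 e)).
Proof.
move=> n_ge2; rewrite edge_bcdc // /share !inE -andb_orl andbC eq_sym.
by rewrite /entry -!/(end1 _) -!/(end2 _).
Qed.

Lemma star_clique n (e x y : bcdc n) u : 2 <= n ->
  x \in star e u -> y \in star e u -> x != y -> edge x y.
Proof.
move=> n_ge2; rewrite !inE edge_bcdc // => /andP[xu _] /andP[yu _] -> /=.
by rewrite /share; case/orP: xu => /eqP <-; rewrite yu ?orbT.
Qed.

Lemma card_star n (e : bcdc n) u : 2 <= n -> entry u (bcdc_words e) ->
  #|star e u| = n - 1.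
Proof.
move=> n_ge2 eu; have [w /size_cq_related su _] := entry_related n_ge2 eu.
have := card_bcdc (entry u) n_ge2; rewrite (degree su) (cardsD1 e) inE eu add1n /= => eq_n.
rewrite -[in RHS]eq_n subn1 /=; apply: eq_card => g.
by rewrite !inE andbC.
Qed.

Section StarSeparation.
Variables (n : nat) (e : bcdc n) (u v : word).
Hypotheses (n_ge2 : 2 <= n) (uv : u != v).
Hypotheses (eu : entry u (bcdc_words e)) (ev : entry v (bcdc_words e)).

Lemma star_disjoint x : x \in star e u -> x \notin star e v.
Proof.
rewrite !inE => /andP[xu x_e]; apply: contra x_e => /andP[xv _].
by apply/eqP/(eq_edge n_ge2 uv).
Qed.

(** An edge at [u] and an edge at [v] meeting in a third vertex would close a
    triangle. *)
Lemma star_separated x y : x \in star e u -> y \in star e v -> ~~ edge x y.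
Proof.
rewrite !inE => /andP[xu x_e] /andP[yv y_e]; apply/negP.
rewrite edge_bcdc // => /andP[_]; rewrite /share.
have [a ua xE] := entry_related n_ge2 xu.
have [b vb yE] := entry_related n_ge2 yv.
have uv_rel : cq_related n u v.
  have [w uw eE] := entry_related n_ge2 eu.
  by move: ev; rewrite eE eq_sym (negbTE uv) /= => /eqP ->.
have av : a != v.
  apply: contra x_e => /eqP av; apply/eqP/(eq_edge n_ge2 uv) => //.
  by rewrite xE -av eqxx orbT.
have bu : b != u.
  apply: contra y_e => /eqP bu; apply/eqP/(eq_edge n_ge2 uv) => //.
  by rewrite yE -bu eqxx orbT.
have meet w : entry w (bcdc_words x) -> entry w (bcdc_words y) -> False.
  rewrite xE yE => /orP[]/eqP-> /orP[]/eqP.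
  - by move/eqP: uv.
  - by move/eqP; rewrite eq_sym (negbTE bu).
  - by move/eqP: av.
  by move=> ab; apply: (triangle_free uv_rel vb); rewrite -ab.
by case/orP; [apply: meet (entry_end1 x)|apply: meet (entry_end2 x)].
Qed.
End StarSeparation.

(** * Small vertex cuts *)

Lemma card_boundary n (X : pred word) : 2 <= n ->
  #|[set g : bcdc n | X (end1 g) != X (end2 g)]| = boundary n X.
Proof. exact: (@card_bcdc n (fun e => X e.1 != X e.2)). Qed.

(** [X] consists of the ends of the edges in one component after the deletion.
    A boundary edge of [X] that was not deleted would be adjacent to this
    component, hence part of it, and both of its ends would be in [X]. *)
Lemma disconnected_side n (W : {set bcdc n}) : 2 <= n ->
    disconnected (delete_vertices W) ->
  exists (X : pred word) (e f : bcdc n),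
    [/\ e \notin W, X (end1 e) && X (end2 e),
        f \notin W, ~~ X (end1 f) && ~~ X (end2 f) &
        forall g : bcdc n, X (end1 g) != X (end2 g) -> g \in W].
Proof.
move=> n_ge2 /existsP[x /existsP[y xy]]; pose D := delete_vertices W.
pose X w := [exists g : D, connect (@edge D) x g && entry w (bcdc_words (val g))].
have X_connect w (g : D) : X w -> entry w (bcdc_words (val g)) -> connect (@edge D) x g.
  case/existsP=> h /andP[xh hw] gw; have [<-//|hg] := eqVneq h g.
  have hg' : val h != val g by rewrite (inj_eq val_inj).
  apply: connect_trans xh (connect1 _); change (is_true (edge (val h) (val g))).
  rewrite (edge_bcdc _ _ n_ge2) hg' /share.
  by case/orP: hw => /eqP <-; rewrite gw ?orbT.
have connect_X w (g : D) : connect (@edge D) x g -> entry w (bcdc_words (val g)) -> X w.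
  by move=> xg gw; apply/existsP; exists g; rewrite xg.
exists X, (val x), (val y); split; [exact: (valP x)| |exact: (valP y)| |].
- by rewrite !(connect_X _ x) ?entry_end1 ?entry_end2.
- apply/andP; split; apply: contra xy => /X_connect; apply;
  by rewrite ?entry_end1 ?entry_end2.
move=> g; apply: contraR => gW; pose g' : D := exist (fun z => z \notin W) g gW.
apply/eqP; apply/idP/idP => [/(X_connect _ g')|/(X_connect _ g')] xg.
  by apply: (connect_X _ g'); rewrite ?xg ?entry_end1 ?entry_end2.
by apply: (connect_X _ g'); rewrite ?xg ?entry_end1 ?entry_end2.
Qed.

Lemma size_edges n : 2 <= n -> 2 * n <= size (cq_edges n).
Proof.
have sizeS m : size (cq_edges m.+1) = 2 * size (cq_edges m) + 2 ^ m.
  by rewrite /= !size_cat !size_map size_words; lia.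
case: n => [|[|n]] // _; elim: n => // n IH.
by rewrite sizeS; have := expn_gt0 2 n.+2; lia.
Qed.

Lemma volume_ge n (X : pred word) s :
  uniq s -> all X s -> all (fun w => size w == n) s -> size s <= volume n X.
Proof.
move=> s_uniq /allP Xs /allP s_n; rewrite /volume -size_filter.
apply: uniq_leq_size => // w ws; rewrite mem_filter Xs //= mem_words.
exact: s_n.
Qed.

Lemma size_end n (e : bcdc n) : (size (end1 e) == n) && (size (end2 e) == n).
Proof. by rewrite !size_tuple !eqxx. Qed.

(** The volume bound leaves room in [X] only for the ends of [e], and the bound
    on [#|W|] leaves room in [W] only for the boundary of [X]. *)
Lemma small_side n (W : {set bcdc n}) (X : pred word) (e : bcdc n) : 2 <= n ->
    X (end1 e) && X (end2 e) -> volume n X <= 2 ->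
    (forall g : bcdc n, X (end1 g) != X (end2 g) -> g \in W) ->
    #|W| <= boundary n X ->
  W \subset star e (end1 e) :|: star e (end2 e).
Proof.
move=> n_ge2 /andP[X1 X2] vol bW leW; have /andP[s1 s2] := size_end e.
have ends w : size w == n -> X w -> (w == end1 e) || (w == end2 e).
  move=> sw Xw; apply: contraT; rewrite negb_or => /andP[w1 w2].
  have := @volume_ge n X [:: w; end1 e; end2 e].
  rewrite /= !inE (negbTE w1) (negbTE w2) (cq_related_neq (related_ends e n_ge2)).
  by rewrite Xw X1 X2 sw s1 s2 => /(_ isT isT isT); lia.
have WE : W = [set g : bcdc n | X (end1 g) != X (end2 g)].
  apply/esym/eqP; rewrite eqEcard card_boundary // leW andbT.
  by apply/subsetP => g; rewrite inE => /bW.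
apply/subsetP => g; rewrite {1}WE inE => Xg.
rewrite -edge_star // edge_bcdc //; apply/andP; split.
  by apply: contraNneq Xg => <-; rewrite X1 X2.
have /andP[g1 g2] := size_end g.
have : X (end1 g) || X (end2 g) by case: (X _) Xg; case: (X _).
rewrite /share /entry -!/(end1 _) -!/(end2 _) ![end1 e == _]eq_sym ![end2 e == _]eq_sym.
by case/orP=> [/(ends _ g1)|/(ends _ g2)] /orP[] ->; rewrite ?orbT.
Qed.

(** With at most [2n - 2] deleted vertices, [boundary_ge3] leaves only two
    elements to [X] or to its complement. *)
Lemma min_vertex_cut n (W : {set bcdc n}) : 4 <= n ->
    disconnected (delete_vertices W) ->
  2 * n - 2 <= #|W| /\ (#|W| <= 2 * n - 2 ->
    exists e : bcdc n, W = star e (end1 e) :|: star e (end2 e)).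
Proof.
move=> n_ge4 disc; have n_ge2 : 2 <= n by lia.
have [X [e [f [_ Xe _ Xf bW]]]] := disconnected_side n_ge2 disc.
have bW' (g : bcdc n) : predC X (end1 g) != predC X (end2 g) -> g \in W.
  by move=> Xg; apply: bW; apply: contraNneq Xg => /= ->.
have le_b : boundary n X <= #|W|.
  rewrite -card_boundary //.
  apply/subset_leq_card/subsetP => g.
  by rewrite inE => /bW.
have ge2 (Y : pred word) (g : bcdc n) : Y (end1 g) && Y (end2 g) -> 2 <= volume n Y.
  move=> Yg; apply: (@volume_ge n Y [:: end1 g; end2 g]).
  - by rewrite /= inE (cq_related_neq (related_ends g n_ge2)).
  - by rewrite /= andbT.
  - by rewrite /= andbT size_end.
have volX := ge2 X e Xe; have volC := ge2 (predC X) f Xf.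
have vol := volume_predC n X.
have b_ge : 2 * n - 2 <= boundary n X by apply: boundary_ge2; lia.
split; first exact: leq_trans le_b.
move=> leW.
suff [g gW] : exists g : bcdc n, W \subset star g (end1 g) :|: star g (end2 g).
  exists g; apply/eqP; rewrite eqEcard gW; apply: leq_trans (leq_card_setU _ _) _.
  by rewrite !card_star ?entry_end1 ?entry_end2 //; lia.
have [vol2|vol3] := leqP (volume n X) 2.
  by exists e; apply: (@small_side n W X) => //; lia.
have [volC2|volC3] := leqP (volume n (predC X)) 2.
  by exists f; apply: (@small_side n W (predC X)) => //; rewrite boundary_predC; lia.
have := @boundary_ge3 n X n_ge4; lia.
Qed.

(** * The lower bound *)

(** Let [a] and [b] count the members inside the first clique and the other
    ones, which are inside the second. Then [n - 1 <= k * a], [n - 1 <= k * b]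
    and [k * (a + b) <= 2 * (n - 1)], so [n - 1 = k * a]. *)
Lemma exact_cover n k (F : {set subgraph (bcdc n)}) (e : bcdc n) : 2 <= n ->
    (forall S, S \in F -> #|sub_vertices S| <= k /\ connected (graph_of_subgraph S)) ->
    family_vertices F = star e (end1 e) :|: star e (end2 e) ->
    k * #|F| <= 2 * n - 2 ->
  k %| n - 1.
Proof.
move=> n_ge2 FP FE le_kF; set A := star e _ in FE; set B := star e _ in FE.
have uv := cq_related_neq (related_ends e n_ge2).
have disj x : x \in A -> x \notin B.
  by apply: star_disjoint; rewrite ?entry_end1 ?entry_end2.
have split_S S : S \in F -> (sub_vertices S \subset A) || (sub_vertices S \subset B).
  move=> SF; have [_ connS] := FP S SF; apply: connected_split => //.
    by rewrite -FE; apply: bigcup_sup.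
  by move=> x y; apply: star_separated; rewrite ?entry_end1 ?entry_end2.
pose FA := F :&: [set S | sub_vertices S \subset A].
pose FB := F :\: [set S | sub_vertices S \subset A].
have cardF : #|FA| + #|FB| = #|F| by rewrite cardsID.
have le_A : #|A| <= k * #|FA|.
  apply: leq_trans _ (card_family_vertices (F := FA) _); last first.
    by move=> S; rewrite inE => /andP[/FP[]].
  apply/subset_leq_card/subsetP => x xA.
  have /bigcupP[S SF xS] : x \in family_vertices F by rewrite FE inE xA.
  apply/bigcupP; exists S => //; rewrite !inE SF /=.
  case/orP: (split_S S SF) => // /subsetP /(_ x xS).
  by rewrite (negbTE (disj x xA)).
have le_B : #|B| <= k * #|FB|.
  apply: leq_trans _ (card_family_vertices (F := FB) _); last first.
    by move=> S; rewrite inE => /andP[_ /FP[]].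
  apply/subset_leq_card/subsetP => x xB.
  have /bigcupP[S SF xS] : x \in family_vertices F by rewrite FE inE xB orbT.
  apply/bigcupP; exists S => //; rewrite !inE SF andbT.
  by apply: contraL xB => /subsetP /(_ x xS); apply: disj.
move: le_A le_B le_kF; rewrite !card_star ?entry_end1 ?entry_end2 // -cardF mulnDr.
by move=> ? ? ?; have -> : n - 1 = k * #|FA|; [lia|rewrite dvdn_mulr].
Qed.

Definition cut_number n k :=
  if [&& 4 <= k, k <= n - 1 & k %| n - 1] then (2 * n - 2) %/ k
  else ceil_div (2 * n - 1) k.

(** Covering [2n - 1] vertices takes at least the larger of the two values, and
    a cut of [2n - 2] vertices with fewer members falls under [exact_cover].
    That the cut leaves a single vertex gives [2n - 1] deleted vertices too,
    because [B_n] has at least [2n] vertices. *)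
Lemma cut_number_le n k (F : {set subgraph (bcdc n)}) : 4 <= n -> 4 <= k ->
  substructure_cut (path_graph k) F -> cut_number n k <= #|F|.
Proof.
move=> n_ge4 k_ge4 cutF; have k_gt0 : 0 < k by lia.
have n_ge2 : 2 <= n by lia.
have FP S : S \in F -> #|sub_vertices S| <= k /\ connected (graph_of_subgraph S).
  by move/(substructureP cutF); rewrite card_ord.
have le_W : #|family_vertices F| <= k * #|F| by apply: card_family_vertices => S /FP[].
have [ge_W eq_W] : 2 * n - 2 <= #|family_vertices F| /\
    (#|family_vertices F| <= 2 * n - 2 -> exists e : bcdc n,
       family_vertices F = star e (end1 e) :|: star e (end2 e)).
  case/orP: (proj1 cutF); first exact: min_vertex_cut.
  rewrite /trivial_graph card_sig => /eqP card1.
  have card_W : #|family_vertices F| + 1 = #|bcdc n|.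
    by rewrite -(cardC (mem (family_vertices F))) -card1.
  have card_V : #|bcdc n| = size (cq_edges n).
    rewrite -count_predT -(card_bcdc predT n_ge2).
    by apply: eq_card => g; rewrite !inE.
  by have := size_edges n_ge2; lia.
have dvd2 : k %| n - 1 -> k %| 2 * n - 2.
  by move=> dvd_k; have -> : 2 * n - 2 = 2 * (n - 1); [lia|rewrite dvdn_mull].
rewrite /cut_number; case: ifP => [/and3P[_ _ /dvd2 dvd_k]|].
  by rewrite leq_divLR // mulnC; lia.
apply: contraFT; rewrite ceil_div_leq // -ltnNge mulnC => lt_F.
have [e FE] := eq_W ltac:(lia).
have dvd_k : k %| n - 1 by apply: exact_cover FP FE _; lia.
by rewrite k_ge4 dvd_k andbT; apply: dvdn_leq => //; lia.
Qed.

(** * The upper bound *)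

Lemma sorted_cat (T : Type) (r : rel T) s x y t :
  sorted r (rcons s x) -> r x y -> sorted r (y :: t) -> sorted r (rcons s x ++ y :: t).
Proof.
case: s => [|z s] /=; first by move=> _ -> ->.
by move=> zs xy yt; rewrite cat_path zs last_rcons /= xy.
Qed.

Lemma sorted_clique (G : sgraph) (s : seq G) : uniq s ->
  {in s &, forall x y, x != y -> edge x y} -> sorted (@edge G) s.
Proof.
move=> s_uniq cl; apply: pairwise_sorted; move: s_uniq; rewrite uniq_pairwise.
by apply: (sub_in_pairwise (P := mem s)) => //; apply/allP.
Qed.

Lemma clique_path (G : sgraph) (K : {set G}) g : g \in K ->
    {in K &, forall x y, x != y -> edge x y} ->
  exists t, [/\ uniq (g :: t), g :: t =i K, size t = #|K|.-1,
    sorted (@edge G) (g :: t) & sorted (@edge G) (rcons t g)].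
Proof.
move=> gK clK; exists (enum (K :\ g)).
have mem_s : g :: enum (K :\ g) =i K.
  by move=> x; rewrite inE mem_enum in_setD1; have [->|] := eqVneq x g.
have uniq_s : uniq (g :: enum (K :\ g)).
  by rewrite /= mem_enum !inE eqxx enum_uniq.
split=> //.
- by rewrite -cardE (cardsD1 g K) gK.
- by apply: sorted_clique => // x y; rewrite !mem_s; apply: clK.
apply: sorted_clique; first by rewrite rcons_uniq.
by move=> x y; rewrite !mem_rcons !mem_s; apply: clK.
Qed.

(** A 4-cycle [u v v' u'] through the edge [(u, v)], found in the copy of [CQ_2]
    on the last two bits. *)
Lemma square n : 2 <= n -> exists u v u' v',
  [/\ (u, v) \in cq_edges n, (u, u') \in cq_edges n, (v, v') \in cq_edges n,
      (u', v') \in cq_edges n & (u != v') && (v != u')].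
Proof.
case: n => [|[|n]] // _; elim: n => [|n [u [v [u' [v' [uv uu vv uv' /andP[d1 d2]]]]]]].
  by exists [:: false; false], [:: false; true], [:: true; false], [:: true; true].
exists (false :: u), (false :: v), (false :: u'), (false :: v').
by rewrite !mem_edgesS /= !eqseq_cons /= d1 d2; split.
Qed.

Lemma isolating_cut n k (F : {set subgraph (bcdc n)}) (e : bcdc n) : 2 <= n ->
    star e (end1 e) :|: star e (end2 e) \subset family_vertices F ->
    e \notin family_vertices F ->
    (forall S, S \in F -> isomorphic (graph_of_subgraph S) (path_graph k)) ->
  structure_cut (path_graph k) F.
Proof.
move=> n_ge2 /subsetP nbhd eF isoF; split=> //.
by apply: (subgraph_cut_isolated eF) => f; rewrite edge_star // => /nbhd.
Qed.

Lemma star_irrefl n (e : bcdc n) u : e \notin star e u.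
Proof. by rewrite inE eqxx andbF. Qed.

(** The path covers of the two cliques have no member in common, since their
    members are nonempty and the cliques disjoint. *)
Lemma two_cliques_cut n k : 2 <= n -> 0 < k -> k <= n - 1 -> k %| n - 1 ->
  exists2 F : {set subgraph (bcdc n)},
    structure_cut (path_graph k) F & #|F| = (2 * n - 2) %/ k.
Proof.
move=> n_ge2 k_gt0 k_le k_dvd.
have [u [v [_ [_ [/(bcdc_of_edge n_ge2)[e _] _ _ _ _]]]]] := square n_ge2.
have cover w : entry w (bcdc_words e) -> exists F : {set subgraph (bcdc n)},
    [/\ #|F| = (n - 1) %/ k, family_vertices F = star e w &
     forall S, S \in F -> isomorphic (graph_of_subgraph S) (path_graph k)].
  move=> ew; have [|||F [cF vF isoF]] := @cover_path _ (enum (star e w)) k.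
  - exact: enum_uniq.
  - apply: sorted_clique (enum_uniq _) _ => x y; rewrite !mem_enum.
    exact: star_clique.
  - by rewrite -cardE card_star // k_gt0.
  exists F; split=> //; last by rewrite vF; apply/setP=> x; rewrite inE mem_enum.
  by rewrite cF -cardE card_star // /ceil_div k_dvd addn0.
have [F1 [c1 v1 iso1]] := cover _ (entry_end1 e).
have [F2 [c2 v2 iso2]] := cover _ (entry_end2 e).
have vF : family_vertices (F1 :|: F2) = star e (end1 e) :|: star e (end2 e).
  by rewrite /family_vertices bigcup_setU -!/(family_vertices _) v1 v2.
exists (F1 :|: F2).
  apply: (isolating_cut n_ge2); first by rewrite vF.
    by rewrite vF inE negb_or !star_irrefl.
  by move=> S; rewrite inE => /orP[/iso1|/iso2].
have F12 : F1 :&: F2 = set0.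
  apply/setP=> S; rewrite !inE; apply/negP => /andP[S1 S2].
  have : 0 < #|sub_vertices S|.
    by rewrite -card_subgraph (isomorphic_card (iso1 S S1)) card_ord.
  case/card_gt0P=> x xS.
  have x1 : x \in star e (end1 e) by rewrite -v1; apply/bigcupP; exists S.
  have : x \in star e (end2 e) by rewrite -v2; apply/bigcupP; exists S.
  apply/negP; apply: star_disjoint x1; rewrite ?entry_end1 ?entry_end2 //.
  exact: cq_related_neq (related_ends e n_ge2).
rewrite cardsU F12 cards0 subn0 c1 c2 addnn -mul2n.
by have -> : 2 * n - 2 = 2 * (n - 1); [lia|rewrite muln_divA].
Qed.

(** The path runs through the edges at [u] up to [g = (u, u')], then
    [m = (u', v')], then [h = (v, v')] and the other edges at [v]. *)
Lemma long_path_cut n k : 2 <= n -> 0 < k <= 2 * n - 1 ->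
  exists2 F : {set subgraph (bcdc n)},
    structure_cut (path_graph k) F & #|F| = ceil_div (2 * n - 1) k.
Proof.
move=> n_ge2 k_le.
have [u [v [u' [v' [uv uu vv uv' /andP[d1 d2]]]]]] := square n_ge2.
have [e we] := bcdc_of_edge n_ge2 uv; have [g wg] := bcdc_of_edge n_ge2 uu.
have [h wh] := bcdc_of_edge n_ge2 vv; have [m wm] := bcdc_of_edge n_ge2 uv'.
have rel x y : (x, y) \in cq_edges n -> x != y.
  by move=> xy; apply: (@cq_related_neq n); rewrite /cq_related xy.
have [nuv nuu nvv] := And3 (rel _ _ uv) (rel _ _ uu) (rel _ _ vv).
have eu : entry u (bcdc_words e) by rewrite we /entry eqxx.
have ev : entry v (bcdc_words e) by rewrite we /entry eqxx orbT.
have neq (x y : bcdc n) : bcdc_words x != bcdc_words y -> x != y.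
  by apply: contraNneq => ->.
have gA : g \in star e u.
  rewrite inE wg /entry eqxx neq // wg we -pair_eqE /pair_eq /= eqxx /=.
  by rewrite eq_sym.
have hB : h \in star e v.
  by rewrite inE wh /entry eqxx neq // wh we -pair_eqE /pair_eq /= eq_sym (negbTE nuv).
have mA : m \notin star e u by rewrite inE wm /entry /= (negbTE nuu) (negbTE d1).
have mB : m \notin star e v by rewrite inE wm /entry /= (negbTE nvv) (negbTE d2).
have star_clique_in w : {in star e w &, forall x y, x != y -> edge x y}.
  by move=> x y; apply: star_clique.
have [tA [uniq_A mem_A size_A _ sorted_A]] := clique_path gA (star_clique_in u).
have [tB [uniq_B mem_B size_B sorted_B _]] := clique_path hB (star_clique_in v).
pose p := rcons tA g ++ m :: h :: tB.
have mem_p x : x \in p = [|| x \in star e u, x == m | x \in star e v].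
  by rewrite mem_cat mem_rcons mem_A [in LHS]in_cons mem_B.
have size_p : size p = 2 * n - 1.
  rewrite size_cat size_rcons /= size_A size_B !card_star //.
  by clear -n_ge2; lia.
have uniq_p : uniq p.
  rewrite cat_uniq; apply/and3P; split; first by rewrite rcons_uniq.
    apply/hasPn => x; rewrite in_cons mem_B mem_rcons mem_A => /orP[/eqP->//|].
    by apply: contraL; apply: star_disjoint.
  by rewrite cons_uniq mem_B mB.
have gm : edge g m.
  rewrite edge_bcdc // /share wg wm /entry /= eqxx orbT andbT neq //.
  by rewrite wg wm -pair_eqE /pair_eq /= (negbTE nuu).
have mh : edge m h.
  rewrite edge_bcdc // /share wh wm /entry /= eqxx !orbT andbT neq //.
  by rewrite wh wm -pair_eqE /pair_eq /= eq_sym (negbTE d2).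
have sorted_p : sorted (@edge (bcdc n)) p.
  by apply: (sorted_cat sorted_A gm); apply/andP; split; [exact: mh|exact: sorted_B].
have [|F [cF vF isoF]] := cover_path uniq_p sorted_p (k := k); first by rewrite size_p.
exists F; last by rewrite cF size_p.
have [e1 e2] : end1 e = u /\ end2 e = v by rewrite /end1 /end2 we.
apply: (isolating_cut n_ge2 (e := e)) => //; rewrite vF.
  by apply/subsetP=> x; rewrite e1 e2 in_setU in_set mem_p => /orP[] ->; rewrite ?orbT.
rewrite inE mem_p !negb_or !star_irrefl andbT /=.
by apply: neq; rewrite we wm -pair_eqE /pair_eq /= (negbTE nuu).
Qed.

Theorem theorem4p11 (n k : nat) (hn : 4 <= n) (hk4 : 4 <= k)
    (hk : k <= 2 * n - 1) :
  let c := if [&& 4 <= k, k <= n - 1 & k %| n - 1]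
           then (2 * n - 2) %/ k
           else ceil_div (2 * n - 1) k in
  kappa_is (bcdc n) (path_graph k) c /\ kappa_s_is (bcdc n) (path_graph k) c.
Proof.
move=> c; have k_gt0 : 0 < k by lia.
have n_ge2 : 2 <= n by lia.
have connP := path_connected k_gt0.
have lower (F : {set subgraph (bcdc n)}) : substructure_cut (path_graph k) F -> c <= #|F|.
  exact: cut_number_le.
have [F cutF cF] : exists2 F : {set subgraph (bcdc n)},
    structure_cut (path_graph k) F & #|F| = c.
  rewrite /c; case: ifP => [/and3P[_ k_le k_dvd]|_]; first exact: two_cliques_cut.
  by apply: long_path_cut; rewrite ?k_gt0.
split; split.
- by exists F.
- by move=> F' /(structure_substructure connP) /lower.
- by exists F => //; apply: structure_substructure.
- exact: lower.
Qed.
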